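(* Let $N\ge 1$ and let $A_1,\dots,A_N$ be $\mathfrak{sl}(2,\mathbb{C})$-valued holomorphic functions of $(\lambda_1,\dots,\lambda_N)$ on an open subset of $\{(\lambda_1,\dots,\lambda_N)\in\mathbb{C}^N:\lambda_i\ne\lambda_j\text{ for }i\ne j\}$ which satisfy the Schlesinger system $$\frac{\partial A_j}{\partial\lambda_i}=\frac{[A_j,A_i]}{\lambda_j-\lambda_i}\quad(i\neq j),\qquad \frac{\partial A_j}{\partial\lambda_j}=-\sum_{i\neq j}\frac{[A_j,A_i]}{\lambda_j-\lambda_i},$$ together with $\sum_{j=1}^N A_j=0$. Let $\tau_{\rm JM}$ be the $\tau$-function of this solution, and for integers $m\ge -1$ let $$L_m:=\sum_{j=1}^N\lambda_j^{m+1}\frac{\partial}{\partial\lambda_j},\qquad \widehat{\mathcal{H}}_m:=L_m\log\tau_{\rm JM}-\frac{m+1}{4}\sum_{j=1}^N\lambda_j^m C_j,\qquad C_j:=\mathrm{tr}\,A_j^2 .$$ Then $\tau_{\rm JM}$ satisfies the following two differential equations. (1) The third order equation with cubic non-linearity: $$\begin{aligned} \tfrac18\left(L_2L_2\widehat{\mathcal{H}}_2+2L_3\widehat{\mathcal{H}}_3-5L_4\widehat{\mathcal{H}}_2-2\widehat{\mathcal{H}}_6\right)^2 ={}&\left(L_3\widehat{\mathcal{H}}_3-L_4\widehat{\mathcal{H}}_2-\widehat{\mathcal{H}}_6\right)\left((\widehat{\mathcal{H}}_3)^2+4\widehat{\mathcal{H}}_2\,(L_2\widehat{\mathcal{H}}_2-\widehat{\mathcal{H}}_4)\right)\\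 &-\left(L_3\widehat{\mathcal{H}}_2-\widehat{\mathcal{H}}_5\right)\left(\widehat{\mathcal{H}}_2\,L_3\widehat{\mathcal{H}}_2+\widehat{\mathcal{H}}_3\,L_2\widehat{\mathcal{H}}_2-\widehat{\mathcal{H}}_2\widehat{\mathcal{H}}_5\right)\\ &+\left(L_2\widehat{\mathcal{H}}_2-\widehat{\mathcal{H}}_4\right)\left(L_2\widehat{\mathcal{H}}_2\right)^2 . \end{aligned}$$ (2) The fourth order equation with quadratic non-linearity: $$\begin{aligned} L_2L_2L_2\widehat{\mathcal{H}}_2={}&8\widehat{\mathcal{H}}_8-9L_4\widehat{\mathcal{H}}_4+10L_5\widehat{\mathcal{H}}_3-4L_3L_3\widehat{\mathcal{H}}_2+10L_4L_2\widehat{\mathcal{H}}_2\\ &-4\left(L_2\widehat{\mathcal{H}}_2\,\bigl(2\widehat{\mathcal{H}}_4-3L_2\widehat{\mathcal{H}}_2\bigr)-\widehat{\mathcal{H}}_3\,\bigl(\widehat{\mathcal{H}}_5-2L_3\widehat{\mathcal{H}}_2\bigr)\right)\\ &-8\widehat{\mathcal{H}}_2\left(2\widehat{\mathcal{H}}_6-3L_3\widehat{\mathcal{H}}_3+4L_4\widehat{\mathcal{H}}_2\right). \end{aligned}$$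
   Context: $[X,Y]=XY-YX$. The $\tau$-function $\tau_{\rm JM}$ of a solution of the Schlesinger system is the (locally defined, nowhere zero, unique up to a multiplicative constant) function of $\lambda_1,\dots,\lambda_N$ determined by $$\frac{\partial}{\partial\lambda_j}\log\tau_{\rm JM}=H_j,\qquad H_j:=\frac12\sum_{k\ne j}\frac{\mathrm{tr}(A_jA_k)}{\lambda_k-\lambda_j},\qquad j=1,\dots,N,$$ so that $L_m\log\tau_{\rm JM}=\sum_{j=1}^N\lambda_j^{m+1}H_j$. The quantities $C_j=\mathrm{tr}\,A_j^2$ are constant (independent of all $\lambda_i$) on solutions of the Schlesinger system. In the equations, each operator $L_m$ acts only on the functions written immediately to its right in the same product of the form $L_{m_1}\cdots L_{m_r}\widehat{\mathcal{H}}_n$ (e.g. $\widehat{\mathcal{H}}_3\,L_2\widehat{\mathcal{H}}_2$ means $\widehat{\mathcal{H}}_3\cdot(L_2\widehat{\mathcal{H}}_2)$, and $L_2\widehat{\mathcal{H}}_2\,(\cdots)$ means $(L_2\widehat{\mathcal{H}}_2)\cdot(\cdots)$). *)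

(* Defs.v *)
From HB Require Import structures.
From mathcomp Require Import all_boot all_order all_algebra.
From mathcomp Require Export complex.
From mathcomp Require Import all_classical all_reals all_analysis.

Set Implicit Arguments.
Unset Strict Implicit.
Unset Printing Implicit Defensive.

Import Order.TTheory GRing.Theory Num.Theory.
Import numFieldNormedType.Exports.

Local Open Scope classical_set_scope.
Local Open Scope ring_scope.

(* R[i], with its structure fixed to numClosedFieldType so that the topology,
   the norm and the derivatives taken below are those over C; in particular
   [differentiable] means complex differentiable, i.e. holomorphic when it
   holds on an open set. *)
Definition Cplx (R : realType) : numClosedFieldType := R[i].

(* Derivative with respect to the j-th coordinate. *)
Definition partial (R : realType) (N : nat) (W : normedModType (Cplx R))
    (j : 'I_N) (f : 'rV[Cplx R]_N -> W) (x : 'rV[Cplx R]_N) : W :=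
  'D_(delta_mx ord0 j) f x.

Definition config_space (R : realType) (N : nat) : set 'rV[Cplx R]_N :=
  [set x | forall i j : 'I_N, i != j -> x ord0 i != x ord0 j].

Definition comm_bracket (R : realType) (X Y : 'M[Cplx R]_2) : 'M[Cplx R]_2 :=
  X *m Y - Y *m X.

Record schlesinger_solution (R : realType) (N : nat) (U : set 'rV[Cplx R]_N)
    (A : 'I_N -> 'rV[Cplx R]_N -> 'M[Cplx R]_2) : Prop := SchlesingerSolution {
  schlesinger_open : open U;
  schlesinger_config : U `<=` config_space (R:=R) (N:=N);
  schlesinger_holo : forall j x, U x -> differentiable (A j) x;
  schlesinger_sl2 : forall j x, U x -> \tr (A j x) = 0;
  schlesinger_offdiag : forall i j x, U x -> i != j ->
    partial i (A j) x =
      (x ord0 j - x ord0 i)^-1 *: comm_bracket (A j x) (A i x);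
  schlesinger_diag : forall j x, U x ->
    partial j (A j) x =
      - \sum_(i < N | i != j)
          (x ord0 j - x ord0 i)^-1 *: comm_bracket (A j x) (A i x)
}.

Definition hamiltonian (R : realType) (N : nat)
    (A : 'I_N -> 'rV[Cplx R]_N -> 'M[Cplx R]_2) (j : 'I_N)
    (x : 'rV[Cplx R]_N) : Cplx R :=
  2^-1 * \sum_(k < N | k != j)
           \tr (A j x *m A k x) / (x ord0 k - x ord0 j).

Definition casimir (R : realType) (N : nat)
    (A : 'I_N -> 'rV[Cplx R]_N -> 'M[Cplx R]_2) (j : 'I_N)
    (x : 'rV[Cplx R]_N) : Cplx R :=
  \tr (A j x *m A j x).

(* The derivative of log tau is the logarithmic derivative of the nowhere zero
   function tau, so no branch of the logarithm has to be chosen. *)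
Record is_tau_function (R : realType) (N : nat) (V : set 'rV[Cplx R]_N)
    (A : 'I_N -> 'rV[Cplx R]_N -> 'M[Cplx R]_2)
    (tau : 'rV[Cplx R]_N -> Cplx R) : Prop := IsTauFunction {
  tau_open : open V;
  tau_holo : forall x, V x -> differentiable tau x;
  tau_neq0 : forall x, V x -> tau x != 0;
  tau_dlog : forall j x, V x -> partial j tau x / tau x = hamiltonian A j x
}.

(* The exponents are integers; they are nonnegative when m >= -1. *)
Definition Lop (R : realType) (N : nat) (m : int)
    (f : 'rV[Cplx R]_N -> Cplx R) (x : 'rV[Cplx R]_N) : Cplx R :=
  \sum_(j < N) (x ord0 j) ^ (m + 1) * partial j f x.

Definition Llog (R : realType) (N : nat) (m : int)
    (tau : 'rV[Cplx R]_N -> Cplx R) (x : 'rV[Cplx R]_N) : Cplx R :=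
  Lop m tau x / tau x.

(* For m = -1 the factor m + 1 vanishes, so the value of 0 ^ (-1) is
   irrelevant. *)
Definition Hhat (R : realType) (N : nat)
    (A : 'I_N -> 'rV[Cplx R]_N -> 'M[Cplx R]_2)
    (tau : 'rV[Cplx R]_N -> Cplx R) (m : int)
    (x : 'rV[Cplx R]_N) : Cplx R :=
  Llog m tau x
  - (m + 1)%:~R / 4 * \sum_(j < N) (x ord0 j) ^ m * casimir A j x.

(* Main.v *)
(** Put B_n = sum_j x_j^n A_j, so that B_0 = 0.  Antisymmetrizing the sums
    in the Hamiltonians gives Hhat_m = -1/4 sum_(a+b=m) tr (B_a B_b), and the
    Schlesinger system gives
      L_m B_n = n B_(m+n) - sum_(a+b=m) [B_(n+a), B_b].
    Hence the functions polynomial in the entries of the B_n form an algebra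
    stable under all L_m, and both equations become polynomial identities in
    the sl(2)-coordinates of B_1, ..., B_7, with these treated as independent
    variables; the cubic equation is the Gram determinant formula for
    (tr (B_1 [B_2, B_3]))^2. *)
Require Import Defs.
From mathcomp Require Import all_boot all_order all_algebra.
From mathcomp Require Import all_classical all_reals all_analysis.
From mathcomp Require Import ring.
Import Order.TTheory GRing.Theory Num.Theory.
Import numFieldNormedType.Exports.
Local Open Scope classical_set_scope.
Local Open Scope ring_scope.

(** * Formal polynomials in the sl(2)-coordinates of the B_n *)

(* A traceless matrix is [[H, E], [F, -H]] in these coordinates. *)
Inductive sl2_coord := coordH | coordE | coordF.

(* [Var n k] stands for the coordinate k of B_n; [Var 0 k] is avoided since
   B_0 = 0. *)
Inductive pexpr (F : Type) :=
  | Cst of F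
  | Var of nat & sl2_coord
  | Add of pexpr F & pexpr F
  | Mul of pexpr F & pexpr F.

Arguments Cst {F}.
Arguments Var {F}.
Arguments Add {F}.
Arguments Mul {F}.

Fixpoint peval {F : pzRingType} (v : nat -> sl2_coord -> F) (e : pexpr F) : F :=
  match e with
  | Cst c => c
  | Var n k => v n k
  | Add e1 e2 => peval v e1 + peval v e2
  | Mul e1 e2 => peval v e1 * peval v e2
  end.

Definition psum {F : pzRingType} (es : seq (pexpr F)) : pexpr F := foldr Add (Cst 0) es.

(** Coordinate [k] of [B_a, B_b]; the factors 2 come from [H, E] = 2E and [F, H] = 2F. *)
Definition pbracket {F : pzRingType} (a b : nat) (k : sl2_coord) : pexpr F :=
  let minor c d := Add (Mul (Var a c) (Var b d))
                       (Mul (Cst (-1)) (Mul (Var a d) (Var b c))) in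
  match k with
  | coordH => minor coordE coordF
  | coordE => Mul (Cst 2) (minor coordH coordE)
  | coordF => Mul (Cst 2) (minor coordF coordH)
  end.

(* The formal L_m. The term [B_(n+m), B_0] of L_m B_n is left out. *)
Fixpoint pder {F : pzRingType} (m : nat) (e : pexpr F) : pexpr F :=
  match e with
  | Cst _ => Cst 0
  | Var n k => Add (Mul (Cst n%:R) (Var (m + n) k))
      (Mul (Cst (-1)) (psum [seq pbracket (n + a) (m - a) k | a <- iota 0 m]))
  | Add e1 e2 => Add (pder m e1) (pder m e2)
  | Mul e1 e2 => Add (Mul (pder m e1) e2) (Mul e1 (pder m e2))
  end.

(* tr (B_a B_b) *)
Definition ptr {F : pzRingType} (a b : nat) : pexpr F :=
  Add (Mul (Cst 2) (Mul (Var a coordH) (Var b coordH)))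
      (Add (Mul (Var a coordE) (Var b coordF)) (Mul (Var a coordF) (Var b coordE))).

(* tr (B_a [B_b, B_c]) *)
Definition ptriple {F : pzRingType} (a b c : nat) : pexpr F :=
  Add (Mul (Cst 2) (Mul (Var a coordH) (pbracket b c coordH)))
      (Add (Mul (Var a coordE) (pbracket b c coordF))
           (Mul (Var a coordF) (pbracket b c coordE))).

(** The terms a = 0 and a = m are left out, since they contain B_0 = 0. *)
Definition pH {F : unitRingType} (m : nat) : pexpr F :=
  Mul (Cst (- 4^-1)) (psum [seq ptr a (m - a) | a <- iota 1 m.-1]).

(* Short forms of L_m Hhat_2 and L_2 L_2 Hhat_2, from which to differentiate
   further: the unsimplified iterated [pder] is too large for [field]. *)
Definition pLH2 {F : unitRingType} (m : nat) : pexpr F :=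
  Mul (Cst (- 2^-1)) (ptr 1 m.+1).

Definition pLLH2 {F : unitRingType} : pexpr F :=
  Mul (Cst (- 2^-1)) (Add (ptr 3 3) (Add (Mul (Cst 3) (ptr 1 5)) (ptriple 1 2 3))).

(** * The polynomial identities behind the two equations *)

Ltac expand_field :=
  rewrite /= ?addSn ?addnS ?subSS ?subn0 ?sub0n ?add0n ?addn0; field => //.

(** The commutators in L_m B_1 cancel in pairs under a -> m-1-a, so L_m B_1 = B_(m+1). In tr (B_1
    L_2 B_3) the bracket [B_4, B_1] contributes nothing, and [B_2, B_3] gives the triple trace. *)
Lemma pder_pH2 (F : numFieldType) (v : nat -> sl2_coord -> F) :
  [/\ peval v (pder 2 (pH 2)) = peval v (pLH2 2),
      peval v (pder 3 (pH 2)) = peval v (pLH2 3),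
      peval v (pder 4 (pH 2)) = peval v (pLH2 4) &
      peval v (pder 2 (pLH2 2)) = peval v pLLH2].
Proof. by split; expand_field. Qed.

(** Write t_ab = tr (B_a B_b) and T = tr (B_1 [B_2, B_3]). The squared expression is -T/2. The three
    differences on the right are t_33/4, t_23/2 and t_22/4, while Hhat_2, Hhat_3 and L_2 Hhat_2 are
    -t_11/4, -t_12/2 and -t_13/2. The right side is thus -1/16 times the Gram determinant G of B_1,
    B_2, B_3, and T^2 = -2G. *)
Lemma pH_cubic (F : numFieldType) (v : nat -> sl2_coord -> F) :
  let E := peval v in
  8^-1 * (E pLLH2 + 2 * E (pder 3 (pH 3)) - 5 * E (pLH2 4) - 2 * E (pH 6)) ^+ 2
  = (E (pder 3 (pH 3)) - E (pLH2 4) - E (pH 6))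
      * (E (pH 3) ^+ 2 + 4 * E (pH 2) * (E (pLH2 2) - E (pH 4)))
    - (E (pLH2 3) - E (pH 5))
      * (E (pH 2) * E (pLH2 3) + E (pH 3) * E (pLH2 2) - E (pH 2) * E (pH 5))
    + (E (pLH2 2) - E (pH 4)) * E (pLH2 2) ^+ 2.
Proof. expand_field. Qed.

(** Applying L_2 to tr (B_1 [B_2, B_3]) creates double commutators; tr ([X,Y][Z,W]) = 2 (tr (XW) tr
    (YZ) - tr (XZ) tr (YW)) in sl(2) turns them into the quadratic terms. The remaining triple
    traces, on indices 1,2,5 and 1,3,4, are matched by the linear terms. *)
Lemma pH_quadratic (F : numFieldType) (v : nat -> sl2_coord -> F) :
  let E := peval v in
  E (pder 2 pLLH2)
  = 8 * E (pH 8) - 9 * E (pder 4 (pH 4)) + 10 * E (pder 5 (pH 3)) - 4 * E (pder 3 (pLH2 3))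
    + 10 * E (pder 4 (pLH2 2))
    - 4 * (E (pLH2 2) * (2 * E (pH 4) - 3 * E (pLH2 2))
           - E (pH 3) * (E (pH 5) - 2 * E (pLH2 3)))
    - 8 * E (pH 2) * (2 * E (pH 6) - 3 * E (pder 3 (pH 3)) + 4 * E (pLH2 4)).
Proof. expand_field. Qed.

(** * Directional derivatives of sums, products and matrix entries *)

Section DirectionalDerivative.
Variables (K : numFieldType) (V : normedModType K).
Implicit Types (x v : V).

Lemma derive_funD (W : normedModType K) (f g : V -> W) x v :
  differentiable f x -> differentiable g x ->
  'D_v (fun y => f y + g y) x = 'D_v f x + 'D_v g x.
Proof. by move=> df dg; apply: deriveD; apply: diff_derivable. Qed.

Lemma derive_funM (f g : V -> K) x v : differentiable f x -> differentiable g x ->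
  'D_v (fun y => f y * g y) x = 'D_v f x * g x + f x * 'D_v g x.
Proof.
move=> df dg; rewrite addrC [X in _ + X]mulrC.
by apply: deriveM; apply: diff_derivable.
Qed.

Lemma derive_lin_comp (W U : normedModType K) (f : V -> W) (h : {linear W -> U}) x v :
  continuous h -> differentiable f x -> 'D_v (h \o f) x = h ('D_v f x).
Proof.
move=> hc df.
have dh : differentiable h (f x) by exact: linear_differentiable.
rewrite (deriveE _ (differentiable_comp df dh)) (deriveE _ df).
by rewrite (diff_comp df dh) (diff_lin _ hc).
Qed.

Lemma derive_mx_entry (p q : nat) (F : V -> 'M[K]_(p, q)) a b x v :
  differentiable F x -> 'D_v (fun y => F y a b) x = ('D_v F x) a b.
Proof.
move=> dF.
(* The entry map is bundled as a linear map so that [derive_lin_comp] applies. *)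
have @h : {linear 'M[K]_(p, q) -> K}.
  by exists (fun M : 'M[K]_(_, _) => M a b); do 2![eexists]; do ?[constructor];
     rewrite ?mxE// => ? *; rewrite ?mxE//; move=> ?; rewrite !mxE.
exact: (derive_lin_comp _ _ F h x v (@coord_continuous _ _ _ a b) dF).
Qed.

Lemma differentiable_mx_entry (p q : nat) (F : V -> 'M[K]_(p, q)) a b x :
  differentiable F x -> differentiable (fun y => F y a b) x.
Proof.
move=> dF.
exact: (differentiable_comp dF (differentiable_coord (F x) a b)).
Qed.

End DirectionalDerivative.

(** * The operators L_m as derivations *)

Section LopRules.
Variables (R : realType) (N : nat).
Local Notation C := (Cplx R).
Implicit Types (m : int) (f g : 'rV[C]_N -> C) (x : 'rV[C]_N).
Local Opaque derive.

Lemma eq_Lop m f g x : {near x, f =1 g} -> Lop m f x = Lop m g x.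
Proof.
move=> fg; apply: eq_bigr => j _.
have fgj : partial j f x = partial j g x by exact: near_eq_derive.
by rewrite fgj.
Qed.

Lemma LopD m f g x : differentiable f x -> differentiable g x ->
  Lop m (fun y => f y + g y) x = Lop m f x + Lop m g x.
Proof.
move=> df dg; rewrite /Lop -big_split; apply: eq_bigr => j _ /=.
by rewrite /partial derive_funD// mulrDr.
Qed.

Lemma LopM m f g x : differentiable f x -> differentiable g x ->
  Lop m (fun y => f y * g y) x = Lop m f x * g x + f x * Lop m g x.
Proof.
move=> df dg; rewrite /Lop mulr_suml mulr_sumr -big_split.
apply: eq_bigr => j _ /=.
by rewrite /partial derive_funM// mulrDr mulrA mulrCA.
Qed.

Lemma Lop_cst m c x : Lop m (fun=> c) x = 0.
Proof. by apply: big1 => j _; rewrite /partial derive_cst mulr0. Qed.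

End LopRules.

Lemma sum_I2 (M : nmodType) (F : 'I_2 -> M) : \sum_(i < 2) F i = F 0 + F 1.
Proof.
rewrite !big_ord_recl big_ord0 addr0.
by congr (_ + F _); apply: val_inj.
Qed.

(** * The moments B_n and the action of L_m on them *)

Section Moments.
Variables (R : realType) (N : nat).
Local Notation C := (Cplx R).
Variables (U : set 'rV[C]_N) (A : 'I_N -> 'rV[C]_N -> 'M[C]_2).
Hypothesis hA : schlesinger_solution U A.
Hypothesis hsum : forall x, U x -> \sum_(j < N) A j x = 0.
Local Opaque derive.
Implicit Types (x : 'rV[C]_N).

Definition moment (n : nat) (x : 'rV[C]_N) : 'M[C]_2 :=
  \sum_(j < N) x ord0 j ^+ n *: A j x.

Lemma moment0 x : U x -> moment 0 x = 0.
Proof.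
by move=> Ux; rewrite -[RHS](hsum x Ux); apply: eq_bigr => j _; rewrite scale1r.
Qed.

Lemma moment_tr n x : U x -> moment n x 1 1 = - moment n x 0 0.
Proof.
move=> Ux; have : \tr (moment n x) = 0.
  rewrite raddf_sum big1// => j _.
  by rewrite /= mxtraceZ (schlesinger_sl2 hA)// mulr0.
by rewrite /mxtrace sum_I2 => /eqP; rewrite addrC addr_eq0 => /eqP.
Qed.

Lemma differentiable_row_entry (j : 'I_N) (x : 'rV[C]_N) :
  differentiable (fun y : 'rV[C]_N => y ord0 j) x.
Proof. exact: differentiable_coord. Qed.

Lemma partial_row_entry (i j : 'I_N) (x : 'rV[C]_N) :
  partial i (fun y : 'rV[C]_N => y ord0 j) x = (i == j)%:R.
Proof.
rewrite /partial (derive_mx_entry _ _ 1 N (fun y : 'rV[C]_N => y) ord0 j).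
  by rewrite derive_id mxE eqxx eq_sym.
by [].
Qed.

Lemma differentiable_row_entryX (j : 'I_N) n (x : 'rV[C]_N) :
  differentiable (fun y : 'rV[C]_N => y ord0 j ^+ n) x.
Proof.
elim: n => [|n IHn]; first exact: differentiable_cst.
under eq_fun do rewrite exprS.
by apply: differentiableM => //; exact: differentiable_row_entry.
Qed.

Lemma partial_row_entryX (i j : 'I_N) n (x : 'rV[C]_N) :
  partial i (fun y : 'rV[C]_N => y ord0 j ^+ n) x =
  n%:R * x ord0 j ^+ n.-1 * (i == j)%:R.
Proof.
elim: n => [|n IHn]; first by rewrite /partial derive_cst !mul0r.
under eq_fun do rewrite exprS.
rewrite /partial derive_funM;
  [|exact: differentiable_row_entry|exact: differentiable_row_entryX].
rewrite -[X in X * _ + _]/(partial _ _ _) partial_row_entry.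
rewrite -[X in _ + _ * X]/(partial _ _ _) IHn.
case: n {IHn} => [|n] /=; first by rewrite !expr0; ring.
rewrite exprS -[n.+2]addn1 natrD; ring.
Qed.

Lemma differentiable_moment n a b x : U x ->
  differentiable (fun y : 'rV[C]_N => moment n y a b) x.
Proof.
move=> Ux.
rewrite (_ : (fun y => _) =
    \sum_(j < N) (fun y : 'rV[C]_N => y ord0 j ^+ n * A j y a b)).
  apply: differentiable_sum => j; apply: differentiableM.
    exact: differentiable_row_entryX.
  by apply: differentiable_mx_entry; exact: (schlesinger_holo hA).
by apply/funext => y; rewrite fct_sumE summxE; apply: eq_bigr => j _; rewrite mxE.
Qed.

Lemma partial_moment i n a b x : U x ->
  partial i (fun y : 'rV[C]_N => moment n y a b) x =
  (n%:R * x ord0 i ^+ n.-1 *: A i x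
   + \sum_(j < N) x ord0 j ^+ n *: partial i (A j) x) a b.
Proof.
move=> Ux.
have dA j : differentiable (A j) x by exact: (schlesinger_holo hA).
have dx j : differentiable (fun y : 'rV[C]_N => y ord0 j ^+ n) x.
  exact: differentiable_row_entryX.
have dAe j : differentiable (fun y : 'rV[C]_N => A j y a b) x.
  exact: differentiable_mx_entry.
rewrite (_ : (fun y => _) =
    \sum_(j < N) (fun y : 'rV[C]_N => y ord0 j ^+ n * A j y a b)); last first.
  by apply/funext => y; rewrite fct_sumE summxE; apply: eq_bigr => j _; rewrite mxE.
rewrite /partial derive_sum => [|j]; last exact/diff_derivable/differentiableM.
under eq_bigr => j _.
  rewrite derive_funM// -[X in X * _ + _]/(partial _ _ _) partial_row_entryX.
  rewrite derive_mx_entry//.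
  over.
rewrite big_split !mxE summxE /=; congr (_ + _).
  rewrite (bigD1 i)//= eqxx mulr1 big1 ?addr0// => j ji.
  by rewrite eq_sym (negPf ji) mulr0 mul0r.
by apply: eq_bigr => j _; rewrite mxE.
Qed.

Lemma comm_bracket_sum (a b : 'I_N -> C) (x : 'rV[C]_N) :
  comm_bracket (\sum_(j < N) a j *: A j x) (\sum_(i < N) b i *: A i x) =
  \sum_(j < N) \sum_(i < N) (a j * b i) *: comm_bracket (A j x) (A i x).
Proof.
rewrite /comm_bracket mulmx_suml [X in _ - X]mulmx_sumr -sumrB.
apply: eq_bigr => j _; rewrite mulmx_sumr mulmx_suml -sumrB.
apply: eq_bigr => i _.
by rewrite -!scalemxAl -!scalemxAr !scalerA [b i * _]mulrC -scalerBr.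
Qed.

Lemma comm_bracketxx (X : 'M[C]_2) : comm_bracket X X = 0.
Proof. exact: subrr. Qed.

(** The diagonal and off-diagonal Schlesinger equations combine into the divided difference of the
    power m+1 at x_j and x_i, which is a polynomial. The index i = j may be included because its
    bracket is zero. *)
Lemma sum_partial_A m j x : U x ->
  \sum_(i < N) x ord0 i ^+ m.+1 *: partial i (A j) x =
  - \sum_(i < N) (\sum_(r < m.+1) x ord0 j ^+ r * x ord0 i ^+ (m - r)) *:
      comm_bracket (A j x) (A i x).
Proof.
move=> Ux.
rewrite (bigD1 j)//= (schlesinger_diag hA)// [in RHS](bigD1 j)//=.
rewrite comm_bracketxx scaler0 add0r scalerN scaler_sumr -!sumrN -big_split.
apply: eq_bigr => i ij /=.
rewrite (schlesinger_offdiag hA)// !scalerA -!scaleNr -scalerDl; congr (_ *: _).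
have xij : x ord0 j - x ord0 i != 0.
  by rewrite subr_eq0 eq_sym; apply: (schlesinger_config hA Ux).
rewrite (_ : \sum_(r < m.+1) _ =
    (x ord0 j ^+ m.+1 - x ord0 i ^+ m.+1) / (x ord0 j - x ord0 i));
  first by rewrite -[_ *: _]/(_ * _); ring.
rewrite subrXX mulrAC mulfV// mul1r (reindex_inj rev_ord_inj)/=.
by apply: eq_bigr => r _; rewrite subSS subKn// -ltnS.
Qed.

(** Each monomial of the divided difference separates j from i, so the double sum factors into
    brackets of moments. *)
Lemma sum_comm_moment m n x :
  \sum_(j < N) x ord0 j ^+ n *:
    \sum_(i < N) (\sum_(r < m.+1) x ord0 j ^+ r * x ord0 i ^+ (m - r)) *:
      comm_bracket (A j x) (A i x) =
  \sum_(r < m.+1) comm_bracket (moment (n + r) x) (moment (m - r) x).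
Proof.
under [RHS]eq_bigr do rewrite comm_bracket_sum.
rewrite [RHS]exchange_big; apply: eq_bigr => j _ /=.
rewrite [RHS]exchange_big scaler_sumr; apply: eq_bigr => i _ /=.
rewrite -scaler_suml scalerA mulr_sumr; congr (_ *: _); apply: eq_bigr => r _.
by rewrite exprD mulrA.
Qed.

Lemma sum_partial_moment m n x : U x ->
  \sum_(i < N) x ord0 i ^+ m.+1 *:
   (n%:R * x ord0 i ^+ n.-1 *: A i x
    + \sum_(j < N) x ord0 j ^+ n *: partial i (A j) x) =
  n%:R *: moment (m + n) x
  - \sum_(r < m) comm_bracket (moment (n + r) x) (moment (m - r) x).
Proof.
move=> Ux; under eq_bigr do rewrite scalerDr scaler_sumr.
rewrite big_split exchange_big /=; congr (_ + _).
  rewrite /moment scaler_sumr; apply: eq_bigr => i _; rewrite !scalerA.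
  (* The exponents m+1 and n.-1 add up to m+n only for n > 0; for n = 0 the factor [n%:R]
     vanishes. *)
  congr (_ *: _); rewrite mulrCA -exprD; case: n => [|n] /=.
    by rewrite !mul0r.
  by rewrite addSnnS.
under eq_bigr => j _.
  under eq_bigr do rewrite scalerA mulrC -scalerA.
  rewrite -scaler_sumr sum_partial_A// scalerN.
  over.
(* The term r = m is [B_(n+m), B_0] = 0, which leaves the range r < m used in [pder]. *)
rewrite sumrN sum_comm_moment big_ord_recr/= subnn moment0//.
by rewrite /comm_bracket mulmx0 mul0mx subrr addr0.
Qed.

Lemma Lop_moment m n a b x : U x ->
  Lop m%:Z (fun y : 'rV[C]_N => moment n y a b) x =
  (n%:R *: moment (m + n) x
   - \sum_(r < m) comm_bracket (moment (n + r) x) (moment (m - r) x)) a b.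
Proof.
move=> Ux; rewrite /Lop -sum_partial_moment// summxE; apply: eq_bigr => i _.
by rewrite partial_moment// -PoszD addn1 -exprnP [in RHS]mxE.
Qed.

Lemma exprz_nat1 (c : C) m : c ^ (m%:Z + 1) = c ^+ m.+1.
Proof. by rewrite -PoszD addn1 -exprnP. Qed.

(** * The functions Hhat_m as quadratic forms in the moments *)

(** Since [G] is antisymmetric, averaging over the exchange of j and k replaces x_j^(m+1) by half of
    x_j^(m+1) - x_k^(m+1), and the denominator cancels. This 1/2 and the one in [hamiltonian] give
    1/4. *)
Lemma sum_hamiltonian m x : U x ->
  \sum_(j < N) x ord0 j ^+ m.+1 * hamiltonian A j x =
  - 4^-1 * \sum_(j < N) \sum_(k < N | k != j)
     (\sum_(r < m.+1) x ord0 j ^+ r * x ord0 k ^+ (m - r)) * \tr (A j x *m A k x).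
Proof.
move=> Ux.
pose G j k := \tr (A j x *m A k x) / (x ord0 k - x ord0 j).
have Ganti j k : G j k = - G k j.
  by rewrite /G mxtrace_mulC -mulrN -invrN opprB.
pose S := \sum_(j < N) \sum_(k < N | k != j) x ord0 j ^+ m.+1 * G j k.
have -> : \sum_(j < N) x ord0 j ^+ m.+1 * hamiltonian A j x = 2^-1 * S.
  rewrite mulr_sumr; apply: eq_bigr => j _.
  by rewrite /hamiltonian mulrCA mulr_sumr.
have SE : S = - \sum_(j < N) \sum_(k < N | k != j) x ord0 k ^+ m.+1 * G j k.
  rewrite /S (exchange_big_dep xpredT)//= -sumrN; apply: eq_bigr => k _.
  rewrite -sumrN; apply: eq_big => [j|j _]; first by rewrite eq_sym.
  by rewrite Ganti mulrN.
have S2 : S + S = - \sum_(j < N) \sum_(k < N | k != j)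
   (\sum_(r < m.+1) x ord0 j ^+ r * x ord0 k ^+ (m - r)) * \tr (A j x *m A k x).
  rewrite {2}SE /S -sumrB -sumrN; apply: eq_bigr => j _.
  rewrite -sumrB -sumrN; apply: eq_bigr => k kj.
  have xkj : x ord0 k - x ord0 j != 0.
    by rewrite subr_eq0; apply: (schlesinger_config hA Ux).
  rewrite -mulrBl -opprB subrXX.
  under [in RHS]eq_bigr do rewrite mulrC.
  by rewrite /G /=; field.
by rewrite mulNr -mulrN -S2; field.
Qed.

(** The Casimir correction in [Hhat] supplies exactly the diagonal j = k, where the inner sum
    consists of m+1 equal terms x_j^m. *)
Lemma Hhat_moment (V : set 'rV[C]_N) tau m x : U x -> is_tau_function V A tau -> V x ->
  Hhat A tau m%:Z x = - 4^-1 * \sum_(r < m.+1) \tr (moment r x *m moment (m - r) x).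
Proof.
move=> Ux htau Vx; rewrite /Hhat /Llog /Lop.
rewrite (_ : _ / tau x = \sum_(j < N) x ord0 j ^+ m.+1 * hamiltonian A j x); last first.
  rewrite mulr_suml; apply: eq_bigr => j _.
  by rewrite exprz_nat1 -mulrA (tau_dlog htau).
rewrite sum_hamiltonian//.
rewrite (_ : \sum_(r < m.+1) _ = \sum_(j < N) \sum_(k < N)
   (\sum_(r < m.+1) x ord0 j ^+ r * x ord0 k ^+ (m - r)) * \tr (A j x *m A k x)); last first.
  under [RHS]eq_bigr do under eq_bigr do rewrite mulr_suml.
  under [RHS]eq_bigr do rewrite exchange_big.
  rewrite [RHS]exchange_big; apply: eq_bigr => r _ /=.
  rewrite mulmx_suml raddf_sum; apply: eq_bigr => j _ /=.
  rewrite mulmx_sumr raddf_sum; apply: eq_bigr => k _ /=.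
  by rewrite -scalemxAl -scalemxAr !mxtraceZ mulrA.
under [in RHS]eq_bigr => j _ do rewrite (bigD1 j)//=.
rewrite big_split/= mulrDr addrC; congr (_ + _).
rewrite mulNr; congr (- _); rewrite !mulr_sumr; apply: eq_bigr => j _.
rewrite -[(m%:Z + 1)%R]/((m + 1)%:Z) -pmulrn.
rewrite (eq_bigr (fun=> x ord0 j ^+ m)) => [|r _]; last first.
  by rewrite -exprD subnKC// -ltnS.
rewrite sumr_const card_ord addn1 -mulr_natl -exprnP /casimir.
ring.
Qed.

(** * Evaluation of formal polynomials at the moments *)

Definition moment_coord (x : 'rV[C]_N) (n : nat) (k : sl2_coord) : C :=
  match k with
  | coordH => moment n x 0 0
  | coordE => moment n x 0 1
  | coordF => moment n x 1 0
  end.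

Lemma peval_psum (v : nat -> sl2_coord -> C) es :
  peval v (psum es) = \sum_(e <- es) peval v e.
Proof.
by elim: es => [|e es IHes]; rewrite ?big_nil// big_cons /= IHes.
Qed.

Lemma peval_pbracket a b k x : U x ->
  peval (moment_coord x) (pbracket a b k) =
  let M := comm_bracket (moment a x) (moment b x) in
  match k with coordH => M 0 0 | coordE => M 0 1 | coordF => M 1 0 end.
Proof.
move=> Ux; have entry i j : comm_bracket (moment a x) (moment b x) i j =
    moment a x i 0 * moment b x 0 j + moment a x i 1 * moment b x 1 j
    - (moment b x i 0 * moment a x 0 j + moment b x i 1 * moment a x 1 j).
  by rewrite !mxE !sum_I2.
case: k => /=; rewrite entry ?moment_tr//; ring.
Qed.

(** Differentiability is carried through the same induction because the sum and product rules
    require it. *)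
Lemma Lop_peval m e x : U x ->
  differentiable (fun y => peval (moment_coord y) e) x /\
  Lop m%:Z (fun y => peval (moment_coord y) e) x = peval (moment_coord x) (pder m e).
Proof.
move=> Ux; elim: e => [c|n k|e1 [d1 L1] e2 [d2 L2]|e1 [d1 L1] e2 [d2 L2]] /=.
- by split; [exact: differentiable_cst | exact: Lop_cst].
- split; first by case: k; exact: differentiable_moment.
  rewrite peval_psum big_map -[X in iota 0 X]subn0 big_mkord.
  under eq_bigr do rewrite peval_pbracket//.
  case: k; rewrite /= Lop_moment// mxE [X in X + _]mxE [X in _ + X]mxE mulN1r;
    congr (_ - _); exact: summxE.
- by split; [exact: differentiableD | rewrite LopD// L1 L2].
- by split; [exact: differentiableM | rewrite LopM// L1 L2].
Qed.

(** Hypothesis and conclusion both range over the open set V, so the result can be fed back to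
    handle iterated operators. *)
Lemma Lop_peval_on (V : set 'rV[C]_N) m e f : open V -> V `<=` U ->
  (forall y, V y -> f y = peval (moment_coord y) e) ->
  forall x, V x -> Lop m%:Z f x = peval (moment_coord x) (pder m e).
Proof.
move=> oV VU fe x Vx; rewrite -(Lop_peval m e x (VU x Vx)).2; apply: eq_Lop.
by near=> y; apply: fe; near: y; exact: open_nbhs_nbhs.
Unshelve. all: by end_near. Qed.

Lemma Hhat_peval (V : set 'rV[C]_N) tau m x : U x -> is_tau_function V A tau -> V x ->
  Hhat A tau m.+1%:Z x = peval (moment_coord x) (pH m.+1).
Proof.
move=> Ux htau Vx; rewrite (Hhat_moment V)//= peval_psum big_map.
(* Both end terms contain B_0; the successor index guarantees that they are distinct. *)
rewrite big_ord_recr big_ord_recl/= subn0 subnn moment0// mul0mx mulmx0 !mxtrace0.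
rewrite add0r addr0 -[iota 1 m]/(iota (1 + 0) m) iotaDl big_map -[X in iota 0 X]subn0.
rewrite big_mkord; congr (_ * _); apply: eq_bigr => r _.
rewrite /bump /= subSS !add1n /mxtrace sum_I2 !mxE !sum_I2.
by rewrite !moment_tr//; ring.
Qed.

End Moments.

Theorem theorem2 (R : realType) (N : nat) (hN : (1 <= N)%N)
    (U : set 'rV[Cplx R]_N) (A : 'I_N -> 'rV[Cplx R]_N -> 'M[Cplx R]_2)
    (hA : schlesinger_solution U A)
    (hsum : forall x, U x -> \sum_(j < N) A j x = 0)
    (V : set 'rV[Cplx R]_N) (hVU : V `<=` U)
    (tau : 'rV[Cplx R]_N -> Cplx R) (htau : is_tau_function V A tau) :
  let L := @Lop R N in
  let H := Hhat A tau in
  forall x : 'rV[Cplx R]_N, V x ->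
  8^-1 * (L 2 (L 2 (H 2)) x + 2 * L 3 (H 3) x - 5 * L 4 (H 2) x
          - 2 * H 6 x) ^+ 2
  = (L 3 (H 3) x - L 4 (H 2) x - H 6 x)
      * (H 3 x ^+ 2 + 4 * H 2 x * (L 2 (H 2) x - H 4 x))
    - (L 3 (H 2) x - H 5 x)
      * (H 2 x * L 3 (H 2) x + H 3 x * L 2 (H 2) x - H 2 x * H 5 x)
    + (L 2 (H 2) x - H 4 x) * L 2 (H 2) x ^+ 2
  /\
  L 2 (L 2 (L 2 (H 2))) x
  = 8 * H 8 x - 9 * L 4 (H 4) x + 10 * L 5 (H 3) x - 4 * L 3 (L 3 (H 2)) x
    + 10 * L 4 (L 2 (H 2)) x
    - 4 * (L 2 (H 2) x * (2 * H 4 x - 3 * L 2 (H 2) x)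
           - H 3 x * (H 5 x - 2 * L 3 (H 2) x))
    - 8 * H 2 x * (2 * H 6 x - 3 * L 3 (H 3) x + 4 * L 4 (H 2) x).
Proof.
move=> L H x Vx.
have oV := tau_open htau.
pose E y := peval (moment_coord R N A y).
have HE m y : V y -> H m.+1%:Z y = E y (pH m.+1).
  by move=> Vy; exact: (Hhat_peval _ _ _ _ hA hsum _ _ _ _ (hVU y Vy) htau Vy).
have LE := Lop_peval_on _ _ _ _ hA hsum V _ _ _ oV hVU.
(* The short forms are proved on all of V, as some of them are differentiated again below. *)
have L22 y : V y -> L 2 (H 2) y = E y (pLH2 2).
  by move=> Vy; rewrite [LHS](LE 2 _ _ (HE 1) y Vy); case: (pder_pH2 _ (moment_coord R N A y)).
have L32 y : V y -> L 3 (H 2) y = E y (pLH2 3).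
  by move=> Vy; rewrite [LHS](LE 3 _ _ (HE 1) y Vy); case: (pder_pH2 _ (moment_coord R N A y)).
have L42 y : V y -> L 4 (H 2) y = E y (pLH2 4).
  by move=> Vy; rewrite [LHS](LE 4 _ _ (HE 1) y Vy); case: (pder_pH2 _ (moment_coord R N A y)).
have L222 y : V y -> L 2 (L 2 (H 2)) y = E y pLLH2.
  by move=> Vy; rewrite [LHS](LE 2 _ _ L22 y Vy); case: (pder_pH2 _ (moment_coord R N A y)).
have L2222 : L 2 (L 2 (L 2 (H 2))) x = E x (pder 2 pLLH2) := LE 2 _ _ L222 x Vx.
have L422 : L 4 (L 2 (H 2)) x = E x (pder 4 (pLH2 2)) := LE 4 _ _ L22 x Vx.
have L332 : L 3 (L 3 (H 2)) x = E x (pder 3 (pLH2 3)) := LE 3 _ _ L32 x Vx.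
have L33 : L 3 (H 3) x = E x (pder 3 (pH 3)) := LE 3 _ _ (HE 2) x Vx.
have L44 : L 4 (H 4) x = E x (pder 4 (pH 4)) := LE 4 _ _ (HE 3) x Vx.
have L53 : L 5 (H 3) x = E x (pder 5 (pH 3)) := LE 5 _ _ (HE 2) x Vx.
have H2 : H 2 x = E x (pH 2) := HE 1 x Vx.
have H3 : H 3 x = E x (pH 3) := HE 2 x Vx.
have H4 : H 4 x = E x (pH 4) := HE 3 x Vx.
have H5 : H 5 x = E x (pH 5) := HE 4 x Vx.
have H6 : H 6 x = E x (pH 6) := HE 5 x Vx.
have H8 : H 8 x = E x (pH 8) := HE 7 x Vx.
have cubic : _ := pH_cubic _ (moment_coord R N A x).
have quadratic : _ := pH_quadratic _ (moment_coord R N A x).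
rewrite -/(E x) in cubic quadratic.
move: (L22 x Vx) (L32 x Vx) (L42 x Vx) (L222 x Vx) => {LE HE}{}L22 {}L32 {}L42 {}L222.
(* With transparent L and H, rewriting would compare integer literals by
   unfolding the derivatives. *)
clearbody L H E.
rewrite L2222 L222 L422 L332 L33 L44 L53 L22 L32 L42 H2 H3 H4 H5 H6 H8.
by split.
Qed.
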